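(* Let $m,n\ge 1$. With pointwise addition of families and the multiplication $\cdot:\mathcal{O}_M^{(m)}\times\mathcal{S}(\mathbb{R}^m,\mathcal{S}_n')\to\mathcal{S}(\mathbb{R}^m,\mathcal{S}_n')$, $(f,v)\mapsto fv=(f(p)v_p)_{p\in\mathbb{R}^m}$, the algebraic structure $(\mathcal{S}(\mathbb{R}^m,\mathcal{S}_n'),+,\cdot)$ is a left module over the ring $(\mathcal{O}_M^{(m)},+,\cdot)$.
   Context: Let $\mathbb{K}$ be $\mathbb{R}$ or $\mathbb{C}$. $\mathcal{S}_n=\mathcal{S}(\mathbb{R}^n,\mathbb{K})$ is the Schwartz space with its usual topology, and $\mathcal{S}_n'$ is its topological dual. $\mathcal{O}_M^{(m)}$ is the space of all $f\in C^\infty(\mathbb{R}^m,\mathbb{K})$ such that $\phi f\in\mathcal{S}_m$ for every $\phi\in\mathcal{S}_m$; it is a commutative ring with identity under pointwise addition and multiplication. $\mathcal{S}(\mathbb{R}^m,\mathcal{S}_n')$ is the set of Schwartz families: families $v=(v_p)_{p\in\mathbb{R}^m}$ in $\mathcal{S}_n'$ such that for every $\phi\in\mathcal{S}_n$ the function $p\mapsto v_p(\phi)$ belongs to $\mathcal{S}_m$. *)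

(* Defs.v *)
From HB Require Import structures.
From mathcomp Require Import all_boot all_order all_algebra.
From mathcomp Require Import complex ring.
From mathcomp Require Import all_classical all_reals all_analysis.

Set Implicit Arguments.
Unset Strict Implicit.
Unset Printing Implicit Defensive.

Import Order.TTheory GRing.Theory Num.Theory.
Import numFieldNormedType.Exports.

Local Open Scope classical_set_scope.
Local Open Scope ring_scope.

Inductive scalar_kind := Reals | Complexes.

(* The scalar field is needed as a normed space over R and as a ring at once.
   No library structure combines these two for R[i] (its numFieldType norm is
   R[i]-valued), so the operations are transported by cases. *)
Definition scalars (R : realType) (k : scalar_kind) : Type :=
  match k with Reals => R | Complexes => Rcomplex R end.

Section scalars_instances.
Variables (R : realType) (k : scalar_kind).
Local Notation K := (scalars R k).

Definition scalars_zero : K :=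
  match k with Reals => 0 : R | Complexes => 0 : Rcomplex R end.
Definition scalars_one : K :=
  match k with Reals => 1 : R | Complexes => 1 : Rcomplex R end.
Definition scalars_opp : K -> K :=
  match k with Reals => fun x : R => - x | Complexes => fun x : Rcomplex R => - x end.
Definition scalars_add : K -> K -> K :=
  match k with
  | Reals => fun x y : R => x + y
  | Complexes => fun x y : Rcomplex R => x + y
  end.
Definition scalars_mul : K -> K -> K :=
  match k with
  | Reals => fun x y : R => x * y
  | Complexes => fun x y : Rcomplex R => x * y
  end.
Definition scalars_scale (a : R) : K -> K :=
  match k with
  | Reals => fun x : R => a * x
  | Complexes => fun x : Rcomplex R => a *: x
  end.
Definition scalars_norm : K -> R :=
  match k with
  | Reals => fun x : R => `|x|
  | Complexes => fun x : Rcomplex R => `|x|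
  end.

HB.instance Definition _ := gen_eqMixin K.
HB.instance Definition _ := gen_choiceMixin K.

Let addA : associative scalars_add.
Proof. by rewrite /scalars_add; case: k => x y z; exact: addrA. Qed.
Let addC : commutative scalars_add.
Proof. by rewrite /scalars_add; case: k => x y; exact: addrC. Qed.
Let add0 : left_id scalars_zero scalars_add.
Proof. by rewrite /scalars_add /scalars_zero; case: k => x; exact: add0r. Qed.
Let addN : left_inverse scalars_zero scalars_opp scalars_add.
Proof.
by rewrite /scalars_add /scalars_opp /scalars_zero; case: k => x; exact: addNr.
Qed.
HB.instance Definition _ := GRing.isZmodule.Build K addA addC add0 addN.

Let mulA : associative scalars_mul.
Proof. by rewrite /scalars_mul; case: k => x y z; exact: mulrA. Qed.
Let mulC : commutative scalars_mul.
Proof. by rewrite /scalars_mul; case: k => x y; exact: mulrC. Qed.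
Let mul1 : left_id scalars_one scalars_mul.
Proof. by rewrite /scalars_mul /scalars_one; case: k => x; exact: mul1r. Qed.
Let mulD : left_distributive scalars_mul scalars_add.
Proof.
by rewrite /scalars_mul /scalars_add; case: k => x y z; exact: mulrDl.
Qed.
Let one_neq0' : scalars_one <> scalars_zero.
Proof.
by rewrite /scalars_one /scalars_zero; case: k; exact/eqP/oner_neq0.
Qed.
Let one_neq0 : scalars_one != scalars_zero.
Proof. exact/eqP. Qed.
HB.instance Definition _ :=
  GRing.Zmodule_isComNzRing.Build K mulA mulC mul1 mulD one_neq0.

Let scaleA (a b : R) v :
  scalars_scale a (scalars_scale b v) = scalars_scale (a * b) v.
Proof.
rewrite /scalars_scale; case: k v => v; first exact: mulrA.
exact: (@scalerA R (Rcomplex R)).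
Qed.
Let scale1 : left_id 1 scalars_scale.
Proof.
rewrite /scalars_scale; case: k => v; first exact: mul1r.
exact: (@scale1r R (Rcomplex R)).
Qed.
Let scaleDr : right_distributive scalars_scale +%R.
Proof.
move=> a; rewrite /GRing.add /= /scalars_add /scalars_scale.
case: k => u v; first exact: mulrDr.
exact: (@scalerDr R (Rcomplex R)).
Qed.
Let scaleDl v : {morph scalars_scale^~ v : a b / a + b}.
Proof.
move=> a b; rewrite [in RHS]/GRing.add /= /scalars_add /scalars_scale.
case: k v => v; first exact: mulrDl.
exact: (@scalerDl R (Rcomplex R)).
Qed.
HB.instance Definition _ :=
  GRing.Zmodule_isLmodule.Build R K scaleA scale1 scaleDr scaleDl.

Let scaleAl (a : R) (u v : K) : a *: (u * v) = (a *: u) * v.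
Proof.
rewrite /GRing.scale /GRing.mul /= /scalars_mul /scalars_scale.
case: k u v => u v; first exact: mulrA.
exact: (@scalerAl R (Rcomplex R)).
Qed.
HB.instance Definition _ := GRing.Lmodule_isLalgebra.Build R K scaleAl.

Let normD (x y : K) :
  scalars_norm (x + y) <= scalars_norm x + scalars_norm y.
Proof.
rewrite /GRing.add /= /scalars_add /scalars_norm.
case: k x y => x y; first exact: ler_normD.
exact: (@ler_normD R (Rcomplex R)).
Qed.
Let normZ (a : R) (x : K) :
  scalars_norm (a *: x) = `|a| * scalars_norm x.
Proof.
rewrite /GRing.scale /= /scalars_scale /scalars_norm.
case: k x => [x|[x y]]; first exact: normrM.
rewrite [in LHS]/Num.norm [X in _ * X]/Num.norm /= -sqrtr_sqr -sqrtrM ?sqr_ge0//.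
by rewrite !exprMn mulrDr.
Qed.
Let norm0 (x : K) : scalars_norm x = 0 -> x = 0.
Proof.
change (scalars_norm x = 0 -> x = scalars_zero).
rewrite /scalars_norm /scalars_zero.
case: k x => x; first exact: normr0_eq0.
exact: (@normr0_eq0 R (Rcomplex R)).
Qed.
HB.instance Definition _ := @Lmodule_isNormed.Build R K scalars_norm normD normZ norm0.

Lemma scalars_normM (x y : K) : `|x * y| = `|x| * `|y|.
Proof.
rewrite /Num.norm /GRing.mul /= /scalars_norm /scalars_mul.
case: k x y => x y; first exact: normrM.
exact: ComplexField.Normc.normcM.
Qed.

End scalars_instances.

Section scalars_calculus.
Variables (R : realType) (k : scalar_kind).
Local Notation K := (scalars R k).

Lemma scalars_scalerAr (a : R) (u v : K) : a *: (u * v) = u * (a *: v).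
Proof. by rewrite mulrC scalerAl mulrC. Qed.

Lemma scalars_cvgM (T : Type) (F : set_system T) (FF : Filter F)
    (f g : T -> K) (a b : K) :
  f @ F --> a -> g @ F --> b -> (fun x => f x * g x) @ F --> a * b.
Proof.
move=> fa gb; apply/subr_cvg0.
have nf : (fun x => `|f x - a|) @ F --> (0 : R^o).
  by apply/norm_cvg0P/subr_cvg0.
have ng : (fun x => `|g x - b|) @ F --> (0 : R^o).
  by apply/norm_cvg0P/subr_cvg0.
apply: norm_cvg0.
have H : (fun x => (`|f x - a| * `|g x - b| + `|a| * `|g x - b|)
            + `|b| * `|f x - a|) @ F --> (0 : R^o).
  have -> : (0 : R^o) = (0 * 0 + `|a| * 0) + `|b| * 0 by rewrite !mulr0 !addr0.
  apply: cvgD; [apply: cvgD|]; apply: cvgM => //; exact: cvg_cst.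
apply: (@squeeze_cvgr _ _ _ _ (cst 0)); [|exact: cvg_cst|exact: H].
near=> x; rewrite normr_ge0/=.
have -> : f x * g x - a * b =
    ((f x - a) * (g x - b) + a * (g x - b)) + b * (f x - a) by ring.
rewrite (le_trans (ler_normD _ _))// scalars_normM lerD2r.
by rewrite (le_trans (ler_normD _ _))// !scalars_normM.
Unshelve. all: by end_near. Qed.

Lemma scalars_is_deriveM (V : normedModType R) (f g : V -> K) x v :
  {for x, continuous g} -> derivable f x v -> derivable g x v ->
  is_derive x v (f * g) ('D_v f x * g x + f x * 'D_v g x).
Proof.
move=> cg df dg.
have key : (fun h => h^-1 *: (((f * g) \o shift x) (h *: v) - (f * g) x)) @ 0^'
    --> 'D_v f x * g x + f x * 'D_v g x.
  rewrite [X in X @ _](_ : _ = fun h =>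
      (h^-1 *: ((f \o shift x) (h *: v) - f x)) * g (h *: v + x) +
      f x * (h^-1 *: ((g \o shift x) (h *: v) - g x))); last first.
    apply/funext => h /=; rewrite -scalerAl -scalars_scalerAr -scalerDr.
    congr (_ *: _); change (f (h *: v + x) * g (h *: v + x) - f x * g x =
      (f (h *: v + x) - f x) * g (h *: v + x) + f x * (g (h *: v + x) - g x)).
    by ring.
  apply: cvgD; apply: scalars_cvgM => //; last exact: cvg_cst.
  have : {for 0, continuous (fun h : R => g (h *: v + x))}.
    apply: (@continuous_comp R V K (fun h => h *: v + x) g).
      apply: (@cvgD R V R); last exact: cvg_cst.
      apply: cvgZr_tmp; exact: cvg_id.
    by rewrite scale0r add0r.
  by move=> /continuous_withinNx; rewrite scale0r add0r.
by split; [apply/cvg_ex; eexists; exact: key|apply: cvg_lim key].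
Qed.

End scalars_calculus.

Section function_spaces.
Variables (R : realType) (k : scalar_kind) (n : nat).
Local Notation K := (scalars R k).
Local Notation E := 'rV[R]_n.
Implicit Types (f g : E -> K) (s : seq 'I_n) (x : E).

Definition basis_vec (i : 'I_n) : E := delta_mx 0 i.

(* Partial derivatives along the directions listed in s, head first. All words
   s are used below instead of multi-indices; for smooth functions the result
   only depends on the number of occurrences of each direction in s. *)
Fixpoint partials s f : E -> K :=
  if s is i :: s' then partials s' ('D_(basis_vec i) f) else f.

Definition smooth f : Prop := forall s,
  continuous (partials s f) /\
  forall i x, derivable (partials s f) x (basis_vec i).

Definition monomial (a : {ffun 'I_n -> nat}) x : R := \prod_i x 0 i ^+ a i.

(* The values |x^a (d_s f)(x)| for j = (a, s); their supremum is the j-th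
   seminorm, and it is a junk value unless they are bounded. *)
Definition weighted_norms (j : {ffun 'I_n -> nat} * seq 'I_n) f : set R :=
  range (fun x => `|monomial j.1 x *: partials j.2 f x|).

Definition is_schwartz f : Prop :=
  smooth f /\ forall j, has_ubound (weighted_norms j f).

Definition seminorm j f : R := sup (weighted_norms j f).

Definition is_multiplier f : Prop :=
  smooth f /\ forall phi, is_schwartz phi -> is_schwartz (phi * f).

Lemma smoothP f : smooth f <->
  [/\ continuous f, forall i x, derivable f x (basis_vec i) &
      forall i, smooth ('D_(basis_vec i) f)].
Proof.
split=> [sf|[cf df sf] [|i s]//=].
  by split=> [|i x|i s]; [exact: (sf [::]).1|exact: (sf [::]).2|exact: (sf (i :: s))].
exact: sf.
Qed.

Lemma smooth_ind (P : (E -> K) -> Prop) f :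
  (forall f, P f -> continuous f /\ forall i x, derivable f x (basis_vec i)) ->
  (forall f i, P f -> P ('D_(basis_vec i) f)) -> P f -> smooth f.
Proof.
move=> P0 PD Pf s; elim: s f Pf => [|i s IH] f Pf /=; first exact: P0.
exact/IH/PD.
Qed.

Lemma smooth_cst (c : K) : smooth (cst c).
Proof.
apply: (@smooth_ind (fun f => exists c, f = cst c)) => [_ [d ->]|_ i [d ->]|].
- by split=> [|i x]; [exact: cst_continuous|exact: derivable_cst].
- by exists 0; apply/funext => x; rewrite derive_cst.
- by exists c.
Qed.

Lemma deriveD_smooth f g i : smooth f -> smooth g ->
  'D_(basis_vec i) (f + g) = 'D_(basis_vec i) f + 'D_(basis_vec i) g.
Proof.
move=> /smoothP[_ df _] /smoothP[_ dg _].
by apply/funext => x; rewrite deriveD.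
Qed.

Lemma deriveM_smooth f g i : smooth f -> smooth g ->
  'D_(basis_vec i) (f * g) = 'D_(basis_vec i) f * g + f * 'D_(basis_vec i) g.
Proof.
move=> /smoothP[_ df _] /smoothP[cg dg _]; apply/funext => x.
by have := scalars_is_deriveM (cg x) (df i x) (dg i x); case.
Qed.

Lemma smoothD f g : smooth f -> smooth g -> smooth (f + g).
Proof.
move=> sf sg; apply: (@smooth_ind (fun h => exists f g,
  [/\ smooth f, smooth g & h = f + g])); last by exists f, g.
- move=> _ [u [v [/smoothP[cu du _] /smoothP[cv dv _] ->]]].
  by split=> [x|i x]; [exact: continuousD (cu x) (cv x)|exact: derivableD].
- move=> _ i [u [v [su sv ->]]]; rewrite deriveD_smooth//.
  exists ('D_(basis_vec i) u), ('D_(basis_vec i) v).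
  by move: su sv => /smoothP[_ _ su] /smoothP[_ _ sv].
Qed.

Inductive sum_of_products : (E -> K) -> Prop :=
| SumOfProductsM f g : smooth f -> smooth g -> sum_of_products (f * g)
| SumOfProductsD f g :
    sum_of_products f -> sum_of_products g -> sum_of_products (f + g).

Lemma sum_of_products_C1 h : sum_of_products h ->
  continuous h /\ forall i x, derivable h x (basis_vec i).
Proof.
elim=> {h} [u v /smoothP[cu du _] /smoothP[cv dv _]|u v _ [cu du] _ [cv dv]].
  split=> [x|i x]; first by
    have H := scalars_cvgM _ (cu x) (cv x); exact: H.
  by case: (scalars_is_deriveM (cv x) (du i x) (dv i x)).
by split=> [x|i x]; [exact: continuousD (cu x) (cv x)|exact: derivableD].
Qed.

Lemma smoothM f g : smooth f -> smooth g -> smooth (f * g).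
Proof.
move=> sf sg; apply: (@smooth_ind sum_of_products); last exact: SumOfProductsM.
  exact: sum_of_products_C1.
move=> h i; elim=> {h} [u v su sv|u v pu IHu pv IHv].
  rewrite deriveM_smooth//; have [_ _ su'] := (smoothP u).1 su.
  have [_ _ sv'] := (smoothP v).1 sv.
  by apply: SumOfProductsD; exact: SumOfProductsM.
rewrite (_ : 'D_(basis_vec i) (u + v) =
  'D_(basis_vec i) u + 'D_(basis_vec i) v); first exact: SumOfProductsD.
by apply/funext => x; rewrite deriveD//; [case: (sum_of_products_C1 pu)|case: (sum_of_products_C1 pv)].
Qed.

Lemma partialsD s f g : smooth f -> smooth g ->
  partials s (f + g) = partials s f + partials s g.
Proof.
elim: s f g => // i s IH f g sf sg /=; rewrite deriveD_smooth// IH//.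
- by case/smoothP: sf.
- by case/smoothP: sg.
Qed.

Lemma partialsZ s (c : K) f : smooth f ->
  partials s (cst c * f) = cst c * partials s f.
Proof.
elim: s f => // i s IH f sf /=.
rewrite deriveM_smooth//; last exact: smooth_cst.
rewrite (_ : 'D_(basis_vec i) (cst c) = 0) ?mul0r ?add0r; last first.
  by apply/funext => x; rewrite derive_cst.
by rewrite IH//; case/smoothP: sf.
Qed.

Lemma weighted_norm_le j f x : is_schwartz f ->
  `|monomial j.1 x *: partials j.2 f x| <= seminorm j f.
Proof. by case=> _ /(_ j) bf; apply: ub_le_sup => //; exists x. Qed.

Lemma seminorm_ge0 j f : is_schwartz f -> 0 <= seminorm j f.
Proof. by move=> /(@weighted_norm_le j _ 0); exact: le_trans. Qed.

Lemma weighted_normsD j f g : is_schwartz f -> is_schwartz g ->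
  ubound (weighted_norms j (f + g)) (seminorm j f + seminorm j g).
Proof.
move=> sf sg _ [x _ <-].
rewrite partialsD; [|by case: sf|by case: sg].
rewrite [(_ + _) x]/GRing.add/= scalerDr (le_trans (ler_normD _ _))//.
by rewrite lerD// weighted_norm_le.
Qed.

Lemma weighted_normsZ j (c : K) f : is_schwartz f ->
  ubound (weighted_norms j (cst c * f)) (`|c| * seminorm j f).
Proof.
move=> sf _ [x _ <-]; rewrite partialsZ; last by case: sf.
rewrite [(_ * _) x]/GRing.mul/= scalars_scalerAr scalars_normM.
by rewrite ler_wpM2l// weighted_norm_le.
Qed.

Lemma is_schwartzD f g : is_schwartz f -> is_schwartz g -> is_schwartz (f + g).
Proof.
move=> sf sg; split; first by apply: smoothD; [case: sf|case: sg].
by move=> j; eexists; exact: weighted_normsD.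
Qed.

Lemma is_schwartzZ (c : K) f : is_schwartz f -> is_schwartz (cst c * f).
Proof.
move=> sf; split; first by apply: smoothM; [exact: smooth_cst|case: sf].
by move=> j; eexists; exact: weighted_normsZ.
Qed.

Lemma cstN1M f : - f = cst (-1) * f.
Proof. by apply/funext => x; change (- f x = -1 * f x); rewrite mulN1r. Qed.

Lemma is_schwartz0 : is_schwartz 0.
Proof.
have D0 s : partials s (0 : E -> K) = 0.
  elim: s => //= i s IH; rewrite [X in partials s X](_ : _ = 0)//.
  by apply/funext => x; rewrite derive_cst.
split; first exact: (smooth_cst 0).
by move=> j; exists 0 => _ [x _ <-]; rewrite D0 scaler0 normr0.
Qed.

Lemma seminormD j f g : is_schwartz f -> is_schwartz g ->
  seminorm j (f + g) <= seminorm j f + seminorm j g.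
Proof.
move=> sf sg; apply: ge_sup; last exact: weighted_normsD.
by eexists; exists 0.
Qed.

Lemma seminorm0 j : seminorm j 0 = 0.
Proof.
have := @weighted_normsZ j 0 _ is_schwartz0; rewrite mulr0 normr0 mul0r.
move=> le0; apply/eqP; rewrite eq_le seminorm_ge0 ?andbT; last exact: is_schwartz0.
by apply: ge_sup => //; eexists; exists 0.
Qed.

Lemma is_multiplier1 : is_multiplier 1.
Proof.
by split=> [|phi sphi]; [exact: (smooth_cst 1)|rewrite mulr1].
Qed.

Lemma is_multiplierB f g :
  is_multiplier f -> is_multiplier g -> is_multiplier (f - g).
Proof.
move=> [sf mf] [sg mg]; split=> [|phi sphi].
  by apply: smoothD => //; rewrite cstN1M; apply: smoothM => //; exact: smooth_cst.
rewrite mulrBr cstN1M; apply: is_schwartzD; first exact: mf.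
exact/is_schwartzZ/mg.
Qed.

Lemma is_multiplierM f g :
  is_multiplier f -> is_multiplier g -> is_multiplier (f * g).
Proof.
move=> [sf mf] [sg mg]; split=> [|phi sphi]; first exact: smoothM.
by rewrite mulrA; apply: mg; exact: mf.
Qed.

End function_spaces.

(* O_M, as a subring of the ring of functions with pointwise operations. *)
Section multipliers.
Variables (R : realType) (k : scalar_kind) (m : nat).
Local Notation K := (scalars R k).
Local Notation E := 'rV[R]_m.

Definition multiplier_pred : {pred E -> K} :=
  fun f => `[< is_multiplier f >].

Record multipliers : Type := Multiplier {
  multiplier_fun :> E -> K;
  _ : multiplier_fun \in multiplier_pred
}.

HB.instance Definition _ := [isSub for multiplier_fun].
HB.instance Definition _ := [Choice of multipliers by <:].

Lemma multiplier_subring_closed : subring_closed multiplier_pred.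
Proof.
split=> [|f g /asboolP mf /asboolP mg|f g /asboolP mf /asboolP mg];
  apply/asboolP.
- exact: is_multiplier1.
- exact: is_multiplierB.
- exact: is_multiplierM.
Qed.

HB.instance Definition _ :=
  GRing.isSubringClosed.Build (E -> K) multiplier_pred multiplier_subring_closed.
HB.instance Definition _ := [SubChoice_isSubComNzRing of multipliers by <:].

End multipliers.

Section schwartz_space.
Variables (R : realType) (k : scalar_kind) (n : nat).
Local Notation K := (scalars R k).
Local Notation E := 'rV[R]_n.

Definition schwartz_pred : {pred E -> K} := fun f => `[< is_schwartz f >].

Record schwartz : Type := Schwartz {
  schwartz_fun :> E -> K;
  _ : schwartz_fun \in schwartz_pred
}.

HB.instance Definition _ := [isSub for schwartz_fun].
HB.instance Definition _ := [Choice of schwartz by <:].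

Lemma schwartzP (phi : schwartz) : is_schwartz phi.
Proof. by case: phi => f /= /asboolP. Qed.

Lemma schwartz_zmod_closed : zmod_closed schwartz_pred.
Proof.
split=> [|f g /asboolP sf /asboolP sg]; apply/asboolP; first exact: is_schwartz0.
by apply: is_schwartzD => //; rewrite cstN1M; exact: is_schwartzZ.
Qed.

HB.instance Definition _ :=
  GRing.isZmodClosed.Build (E -> K) schwartz_pred schwartz_zmod_closed.
HB.instance Definition _ := [SubChoice_isSubZmodule of schwartz by <:].

Lemma schwartz_scale_subproof (c : K) (phi : schwartz) :
  cst c * (phi : E -> K) \in schwartz_pred.
Proof. by apply/asboolP; exact/is_schwartzZ/schwartzP. Qed.

Definition schwartz_scale (c : K) (phi : schwartz) : schwartz :=
  Schwartz (schwartz_scale_subproof c phi).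

Let scaleA (a b : K) (phi : schwartz) :
  schwartz_scale a (schwartz_scale b phi) = schwartz_scale (a * b) phi.
Proof. by apply: val_inj; rewrite /= mulrA. Qed.
Let scale1 : left_id 1 schwartz_scale.
Proof. by move=> phi; apply: val_inj; exact: mul1r. Qed.
Let scaleDr : right_distributive schwartz_scale +%R.
Proof. by move=> a phi psi; apply: val_inj; exact: mulrDr. Qed.
Let scaleDl phi : {morph schwartz_scale^~ phi : a b / a + b}.
Proof. by move=> a b; apply: val_inj; exact: mulrDl. Qed.
HB.instance Definition _ :=
  GRing.Zmodule_isLmodule.Build K schwartz scaleA scale1 scaleDr scaleDl.

(* The locally convex topology of the seminorms: the finite intersections of
   open seminorm balls around phi form a base of neighbourhoods of phi. *)
Definition schwartz_ball (js : seq ({ffun 'I_n -> nat} * seq 'I_n)) (e : R)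
    (phi : schwartz) : set schwartz :=
  [set psi : schwartz | forall j, j \in js -> seminorm j (psi - phi) < e].

Definition schwartz_nbhs (phi : schwartz) : set_system schwartz :=
  [set U | exists js e, 0 < e /\ schwartz_ball js e phi `<=` U].

HB.instance Definition _ := hasNbhs.Build schwartz schwartz_nbhs.

Lemma schwartz_ball_center js e phi : 0 < e -> schwartz_ball js e phi phi.
Proof. by move=> e0 j _; rewrite subrr seminorm0. Qed.

Let nbhs_pfilter (phi : schwartz) : ProperFilter (nbhs phi).
Proof.
split; last split.
- by move=> [js [e [e0 /(_ phi)]]]; apply; exact: schwartz_ball_center.
- by exists [::], 1.
- move=> U V [js [e [e0 U']]] [js' [e' [e'0 V']]].
  exists (js ++ js'), (Num.min e e'); split; first by rewrite lt_min e0.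
  move=> psi psiB; split.
    apply: U' => j jjs; have := psiB j; rewrite mem_cat jjs => /(_ isT).
    by rewrite lt_min => /andP[].
  apply: V' => j jjs; have := psiB j; rewrite mem_cat jjs orbT => /(_ isT).
  by rewrite lt_min => /andP[].
- move=> U V UV [js [e [e0 U']]]; exists js, e; split=> //.
  exact: subset_trans UV.
Qed.

Let nbhs_center (phi : schwartz) (U : set schwartz) : nbhs phi U -> U phi.
Proof. by move=> [js [e [e0]]]; apply; exact: schwartz_ball_center. Qed.

Let nbhs_open (phi : schwartz) (U : set schwartz) : nbhs phi U -> nbhs phi (nbhs^~ U).
Proof.
move=> [js [e [e0 U']]]; exists js, (e / 2); split; first by rewrite divr_gt0.
move=> psi psiB; exists js, (e / 2); split; first by rewrite divr_gt0.
move=> xi xiB; apply: U' => j jjs.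
have -> : xi - phi = (xi - psi) + (psi - phi) by rewrite addrA subrK.
rewrite (le_lt_trans (seminormD _ (schwartzP (xi - psi)) (schwartzP (psi - phi))))//.
by rewrite [e]splitr ltrD// ?xiB ?psiB.
Qed.

HB.instance Definition _ :=
  Nbhs_isNbhsTopological.Build schwartz nbhs_pfilter nbhs_center nbhs_open.

(* The topological dual of the Schwartz space; K^o is K as a module over
   itself, so that functionals are K-linear. *)
Record tempered : Type := Tempered {
  tempered_fun :> {linear schwartz -> K^o};
  tempered_continuous : continuous (tempered_fun : schwartz -> K)
}.

End schwartz_space.

Record schwartz_family (R : realType) (k : scalar_kind) (m n : nat) : Type :=
  SchwartzFamily {
    family_at :> 'rV[R]_m -> tempered R k n;
    family_schwartz : forall phi : schwartz R k n,
      is_schwartz (fun p => family_at p phi : scalars R k)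
  }.

(* Main.v *)
Require Import Defs.
From HB Require Import structures.
From mathcomp Require Import all_boot all_order all_algebra.
From mathcomp Require Import all_classical all_reals all_analysis.

Set Implicit Arguments.
Unset Strict Implicit.
Unset Printing Implicit Defensive.

Import GRing.Theory numFieldNormedType.Exports.
Local Open Scope ring_scope.

(* The module laws hold pointwise; only the closure of the operations has
   content. The dual is itself a K-vector space, since sums and scalar multiples
   of continuous functionals are continuous. A sum of Schwartz families has
   Schwartz coefficients since the Schwartz space is additive, and so does [f v]
   since multipliers preserve that space. *)

(** Besides its function, a bundled linear map carries only proofs of additivity and homogeneity,
    which proof irrelevance identifies. *)
Lemma linear_ext (A : pzRingType) (U V : lmodType A) (u v : {linear U -> V}) :
  u =1 v -> u = v.
Proof.
case: u v => u [[uD] [uZ]] [v [[vD] [vZ]]] /= /funext uv.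
(* Eliminating the equality of functions gives the two pairs of proofs the same types, so that they
   can be compared. *)
case: _ / uv vD vZ => vD vZ.
by rewrite (Prop_irrelevance uD vD) (Prop_irrelevance uZ vZ).
Qed.

Section tempered_lmodule.
Variables (R : realType) (k : scalar_kind) (n : nat).
Local Notation K := (scalars R k).
Local Notation S := (schwartz R k n).
Local Notation T := (tempered R k n).
Implicit Types (u v : T) (phi : S).

Lemma tempered_ext u v : (forall phi, u phi = v phi) -> u = v.
Proof.
case: u v => [u cu] [v cv] /= uv.
have uvE : u = v by exact: linear_ext.
by case: _ / uvE cv => cv; congr Tempered; exact: Prop_irrelevance.
Qed.

(** On [K^o] scaling is multiplication in [K], so a product of limits with one constant factor
    suffices. *)
Lemma tempered_scale_continuous (c : K) u :
  continuous (c \*: (u : {linear S -> K^o}) : S -> K).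
Proof.
move=> phi.
have H := @scalars_cvgM R k S (nbhs phi) _ _ _ _ _ (@cvg_cst K c S (nbhs phi) _)
  (@tempered_continuous _ _ _ u phi).
exact: H.
Qed.

Lemma tempered_add_continuous u v :
  continuous ((u : {linear S -> K^o}) \+ (v : {linear S -> K^o}) : S -> K).
Proof.
move=> phi.
(* Limits are taken in [K] as a normed space over [R], although the functionals are linear into
   [K^o]. *)
exact: (@cvgD R K S (nbhs phi) _ _ _ _ _
  (@tempered_continuous _ _ _ u phi) (@tempered_continuous _ _ _ v phi)).
Qed.

Lemma tempered_zero_continuous : continuous (\0 : S -> K).
Proof. by move=> phi; exact: (@cvg_cst K 0 S (nbhs phi) _). Qed.

Definition tempered_zero : T :=
  @Tempered R k n (\0 : {linear S -> K^o}) tempered_zero_continuous.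
Definition tempered_add u v : T :=
  @Tempered R k n ((u : {linear S -> K^o}) \+ (v : {linear S -> K^o}))
    (@tempered_add_continuous u v).
Definition tempered_scale (c : K) u : T :=
  @Tempered R k n (c \*: (u : {linear S -> K^o}))
    (@tempered_scale_continuous c u).

HB.instance Definition _ := gen_eqMixin T.
HB.instance Definition _ := gen_choiceMixin T.

Let addA : associative tempered_add.
Proof. by move=> u v w; apply: tempered_ext => phi; exact: addrA. Qed.
Let addC : commutative tempered_add.
Proof. by move=> u v; apply: tempered_ext => phi; exact: addrC. Qed.
Let add0 : left_id tempered_zero tempered_add.
Proof. by move=> u; apply: tempered_ext => phi; exact: add0r. Qed.
(** Taking scaling by -1 as the opposite makes its continuity a case of
    [tempered_scale_continuous]. *)
Let addN : left_inverse tempered_zero (tempered_scale (-1)) tempered_add.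
Proof.
move=> u; apply: tempered_ext => phi.
change (-1 * (u phi : K) + u phi = 0 :> K).
by rewrite mulN1r addNr.
Qed.
HB.instance Definition _ := GRing.isZmodule.Build T addA addC add0 addN.

Let scaleA (a b : K) u :
  tempered_scale a (tempered_scale b u) = tempered_scale (a * b) u.
Proof. by apply: tempered_ext => phi; exact: mulrA. Qed.
Let scale1 : left_id 1 tempered_scale.
Proof. by move=> u; apply: tempered_ext => phi; exact: mul1r. Qed.
Let scaleDr : right_distributive tempered_scale +%R.
Proof. by move=> a u v; apply: tempered_ext => phi; exact: mulrDr. Qed.
Let scaleDl u : {morph tempered_scale^~ u : a b / a + b}.
Proof. by move=> a b; apply: tempered_ext => phi; exact: mulrDl. Qed.
HB.instance Definition _ :=
  GRing.Zmodule_isLmodule.Build K T scaleA scale1 scaleDr scaleDl.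

End tempered_lmodule.

Section schwartz_family_lmodule.
Variables (R : realType) (k : scalar_kind) (m n : nat).
Local Notation K := (scalars R k).
Local Notation S := (schwartz R k n).
Local Notation OM := (multipliers R k m).
Local Notation F := (schwartz_family R k m n).
Implicit Types (v w : F) (f g : OM).

Lemma schwartz_family_ext v w : (forall p, v p = w p) -> v = w.
Proof.
case: v w => [v sv] [w sw] /= /funext vw.
by case: _ / vw sw => sw; congr SchwartzFamily; exact: Prop_irrelevance.
Qed.

Lemma is_multiplier_multiplier f : is_multiplier f.
Proof. by case: f => f /= /asboolP. Qed.

Lemma family_zero_schwartz (phi : S) :
  is_schwartz (fun p : 'rV[R]_m => (0 : tempered R k n) phi : K).
Proof. exact: is_schwartz0. Qed.

Lemma family_add_schwartz v w (phi : S) :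
  is_schwartz (fun p => (v p + w p) phi : K).
Proof. by apply: is_schwartzD; exact: family_schwartz. Qed.

Lemma family_scale_schwartz f v (phi : S) :
  is_schwartz (fun p => (f p *: v p) phi : K).
Proof.
have [_ /(_ _ (family_schwartz v phi))] := is_multiplier_multiplier f.
(* In [is_multiplier] the Schwartz function is the left factor, here the right one. *)
by rewrite mulrC.
Qed.

Definition family_zero : F := SchwartzFamily family_zero_schwartz.
Definition family_add v w : F := SchwartzFamily (family_add_schwartz v w).
Definition family_scale f v : F := SchwartzFamily (family_scale_schwartz f v).

HB.instance Definition _ := gen_eqMixin F.
HB.instance Definition _ := gen_choiceMixin F.

Let addA : associative family_add.
Proof. by move=> u v w; apply: schwartz_family_ext => p; exact: addrA. Qed.
Let addC : commutative family_add.
Proof. by move=> u v; apply: schwartz_family_ext => p; exact: addrC. Qed.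
Let add0 : left_id family_zero family_add.
Proof. by move=> u; apply: schwartz_family_ext => p; exact: add0r. Qed.
(** The constant -1 is an element of the ring of multipliers, so the opposite family is again
    Schwartz by [family_scale_schwartz]. *)
Let addN : left_inverse family_zero (family_scale (-1)) family_add.
Proof.
move=> v; apply: schwartz_family_ext => p.
by change (-1 *: v p + v p = 0); rewrite scaleN1r addNr.
Qed.
HB.instance Definition _ := GRing.isZmodule.Build F addA addC add0 addN.

(** The product of multipliers evaluates at [p] to [f p * g p] by computation, which leaves the
    associativity law of the dual over [K]. *)
Let scaleA f g v : family_scale f (family_scale g v) = family_scale (f * g) v.
Proof. by apply: schwartz_family_ext => p; exact: scalerA. Qed.
Let scale1 : left_id 1 family_scale.
Proof. by move=> v; apply: schwartz_family_ext => p; exact: scale1r. Qed.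
Let scaleDr : right_distributive family_scale +%R.
Proof. by move=> f v w; apply: schwartz_family_ext => p; exact: scalerDr. Qed.
Let scaleDl v : {morph family_scale^~ v : f g / f + g}.
Proof. by move=> f g; apply: schwartz_family_ext => p; exact: scalerDl. Qed.
HB.instance Definition _ :=
  GRing.Zmodule_isLmodule.Build OM F scaleA scale1 scaleDr scaleDl.

End schwartz_family_lmodule.

(** The witness [c] packs all the module laws; the two formulas pin its addition and its action to
    the pointwise ones, since families are determined by their values on test functions. *)
Theorem mainTheorem3 (R : realType) (k : scalar_kind) (m n : nat)
    (m_ge1 : (1 <= m)%N) (n_ge1 : (1 <= n)%N) :
  exists c : GRing.Lmodule.axioms_ (multipliers R k m) (schwartz_family R k m n),
  let V : lmodType (multipliers R k m) := GRing.Lmodule.Pack c in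
  (forall (v w : V) (p : 'rV[R]_m) (phi : schwartz R k n),
     (v + w : schwartz_family R k m n) p phi =
     (v : schwartz_family R k m n) p phi + (w : schwartz_family R k m n) p phi)
  /\
  (forall (f : multipliers R k m) (v : V) (p : 'rV[R]_m) (phi : schwartz R k n),
     (f *: v : schwartz_family R k m n) p phi =
     (f p : scalars R k) * (v : schwartz_family R k m n) p phi).
(* For the structure built above, both formulas hold by computation. *)
Proof. by exists (GRing.Lmodule.class (schwartz_family R k m n)). Qed.
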